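(* Let $v$ be a typical weight, let $T:\mathcal{H}(\mathbb{D})\to\mathcal{H}(\mathbb{D})$ be a linear transformation, and let $X\subset\mathcal{H}(\mathbb{D})$ be a Banach space. For $z\in\mathbb{D}$ define the linear maps $(K_z^H)_T(f)=Tf(z)$, $(K_{z,1}^{\mathcal{B}})_T(f)=(Tf)'(z)$ on $X$, and $(K_0^{\mathcal{B}})_T(f)=Tf(0)$. Then: (i) $T:X\to H_{v,0}$ is bounded if and only if $(K_z^H)_T\in X^*$ for all $z\in\mathbb{D}$ and $v(z)(K_z^H)_T\to 0$ weak$^*$ in $X^*$ as $|z|\to1$. (ii) $T:X\to\mathcal{B}_{v,0}$ is bounded if and only if $(K_0^{\mathcal{B}})_T\in X^*$, $(K_{z,1}^{\mathcal{B}})_T\in X^*$ for all $z\in\mathbb{D}$, and $v(z)(K_{z,1}^{\mathcal{B}})_T\to 0$ weak$^*$ in $X^*$ as $|z|\to1$.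
   Context: $\mathbb{D}$ is the open unit disk, $\mathcal{H}(\mathbb{D})$ the holomorphic functions on $\mathbb{D}$. A weight is a continuous $v:\mathbb{D}\to(0,1]$; it is typical if it is radial ($v(z)=v(|z|)$), non-increasing in $|z|$, and $\lim_{|z|\to1}v(z)=0$. $H_v=\{f:\sup_z v(z)|f(z)|<\infty\}$ with norm $\sup_z v(z)|f(z)|$; $\mathcal{B}_v=\{f:\sup_z v(z)|f'(z)|<\infty\}$ with norm $|f(0)|+\sup_z v(z)|f'(z)|$. The little growth spaces are $H_{v,0}=\{f\in\mathcal{H}(\mathbb{D}):\lim_{|z|\to1}v(z)|f(z)|=0\}$ and $\mathcal{B}_{v,0}=\{f\in\mathcal{H}(\mathbb{D}):\lim_{|z|\to1}v(z)|f'(z)|=0\}$, closed subspaces of $H_v$, $\mathcal{B}_v$. $X^*$ is the dual of $X$. *)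

(* Defs.v *)
From HB Require Import structures.
From mathcomp Require Import all_boot all_order all_algebra.
From mathcomp Require Import all_classical all_reals all_analysis.
From mathcomp Require Import complex.
Set Implicit Arguments. Unset Strict Implicit. Unset Printing Implicit Defensive.
Import Order.TTheory GRing.Theory Num.Theory.
Import numFieldNormedType.Exports.
Local Open Scope ring_scope.

(* the complex field C = R[i], as a numClosedFieldType (so that
   MathComp-Analysis's normed/topological structures apply) *)
Definition Cx (R : realType) : numClosedFieldType := R[i].
Definition RtoC (R : realType) (r : R) : Cx R := (r%:C)%C.

Section Defs.
Variable R : realType.
Local Notation C := (Cx R).
Local Notation "r %:C" := (@RtoC R r).

Definition inD (z : C) : Prop := `|z| < 1.
Local Notation D := (fun z : C => `|z| < 1).

Definition holo (f : C -> C) : Prop := forall z, inD z -> derivable f z 1.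

Definition tends0_bdry (g : C -> C) : Prop :=
  forall e : R, 0 < e -> exists r : R, r < 1 /\
    forall z : C, r%:C < `|z| -> inD z -> `|g z| < e%:C.

Definition weight (v : C -> R) : Prop :=
  {in D, continuous v} /\ (forall z, inD z -> 0 < v z <= 1).

Definition typical_weight (v : C -> R) : Prop :=
  [/\ weight v,
      (forall z w, inD z -> inD w -> `|z| = `|w| -> v z = v w),
      (forall z w, inD z -> inD w -> `|z| <= `|w| -> v w <= v z)
    & (forall e : R, 0 < e -> exists r : R, r < 1 /\
         forall z : C, r%:C < `|z| -> inD z -> v z < e)].

Definition Hv0 (v : C -> R) (f : C -> C) : Prop :=
  holo f /\ tends0_bdry (fun z => (v z)%:C * f z).

Definition Bv0 (v : C -> R) (f : C -> C) : Prop :=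
  holo f /\ tends0_bdry (fun z => (v z)%:C * derive1 f z).

Definition linear_on_HD (T : (C -> C) -> (C -> C)) : Prop :=
  (forall f, holo f -> holo (T f)) /\
  (forall (a : C) f g, holo f -> holo g -> forall z, inD z ->
     T (fun w => a * f w + g w) z = a * T f z + T g z).

(* X is a Banach space contained in H(D): a complete normed C-space with a
   linear injective map j into H(D) (functions identified on D) *)
Definition embeds_in_HD (X : completeNormedModType C) (j : X -> (C -> C)) : Prop :=
  [/\ forall x, holo (j x),
      (forall (a : C) x y, j (a *: x + y) = (fun w => a * j x w + j y w))
    & (forall x y, (forall z, inD z -> j x z = j y z) -> x = y)].

Definition bounded_to_Hv0 (v : C -> R) (X : completeNormedModType C)
  (j : X -> (C -> C)) (T : (C -> C) -> (C -> C)) : Prop :=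
  (forall x, Hv0 v (T (j x))) /\
  exists M : R, forall x z, inD z -> (v z)%:C * `|T (j x) z| <= M%:C * `|x|.

(* T : X -> B_{v,0} is bounded (norm |f(0)| + sup v|f'|) *)
Definition bounded_to_Bv0 (v : C -> R) (X : completeNormedModType C)
  (j : X -> (C -> C)) (T : (C -> C) -> (C -> C)) : Prop :=
  (forall x, Bv0 v (T (j x))) /\
  exists M : R, forall x z, inD z ->
     `|T (j x) 0| + (v z)%:C * `|derive1 (T (j x)) z| <= M%:C * `|x|.

End Defs.

Definition KH (R : realType) (X : completeNormedModType (Cx R))
  (j : X -> (Cx R -> Cx R)) (T : (Cx R -> Cx R) -> (Cx R -> Cx R)) (z : Cx R) :
  X -> Cx R := fun x => T (j x) z.
Definition KB0 (R : realType) (X : completeNormedModType (Cx R))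
  (j : X -> (Cx R -> Cx R)) (T : (Cx R -> Cx R) -> (Cx R -> Cx R)) :
  X -> Cx R := fun x => T (j x) 0.
Definition KB1 (R : realType) (X : completeNormedModType (Cx R))
  (j : X -> (Cx R -> Cx R)) (T : (Cx R -> Cx R) -> (Cx R -> Cx R)) (z : Cx R) :
  X -> Cx R := fun x => derive1 (T (j x)) z.

(* a linear functional L : X -> C belongs to X^* iff it is continuous
   (linearity of the K's is automatic from linearity of T and j) *)
Definition in_dual (R : realType) (X : completeNormedModType (Cx R))
  (L : X -> Cx R) : Prop := continuous L.

Definition weakstar_to0_bdry (R : realType) (X : completeNormedModType (Cx R))
  (v : Cx R -> R) (L : Cx R -> X -> Cx R) : Prop :=
  forall x : X, tends0_bdry (fun z => RtoC (v z) * L z x).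

(* Main.v *)
Require Import Defs.
From HB Require Import structures.
From mathcomp Require Import all_boot all_order all_algebra.
From mathcomp Require Import all_classical all_reals all_analysis.
From mathcomp Require Import complex.
From mathcomp Require Import ring lra.
Set Implicit Arguments. Unset Strict Implicit. Unset Printing Implicit Defensive.
Import Order.TTheory GRing.Theory Num.Theory.
Import numFieldNormedType.Exports.
Local Open Scope classical_set_scope.
Local Open Scope ring_scope.

(** For [x] in [X], weak-star convergence says exactly that [v(z) K_z(x)] tends to
    [0] at the boundary, so everything reduces to bounding the functionals
    [v(z) K_z], [|z| < 1], uniformly; by the uniform boundedness principle a
    pointwise bound suffices. Near the boundary it comes from the convergence, and
    on a smaller disc from compactness, once [Tf] and [(Tf)'] are known to be
    locally bounded.

    For the derivative of a function that is merely complex differentiable this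
    needs Cauchy's estimate. Goursat's bisection shows that
    [G(z) = (f(w+z) - f(w) - l z) / (-l z^2)], with [l = f'(w)], has zero integral
    around a square centred at [0] ([z G(z)] tends to [0], so the origin does not
    contribute). On the boundary [G(z)] is [1/z] up to an error of order
    [M / (rho^2 |l|)]. If [|l|] were large compared with [M / rho], the imaginary
    part of [G dz] would therefore be positive all along the boundary. *)

(** * Real-valued norms on complex normed spaces *)

Section RealNorm.
Variable R : realType.
Local Notation C := (Cx R).

(* The norm of the library takes its values in [C]. *)
Definition nm (V : normedModType C) (x : V) : R := complex.Re (`|x| : C).

Lemma nmE (V : normedModType C) (x : V) : `|x| = RtoC (nm x).
Proof. by rewrite /RtoC /nm RRe_real // ger0_real. Qed.

Lemma RtoC_le (a b : R) : (RtoC a <= RtoC b) = (a <= b).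
Proof. exact: lecR. Qed.

Lemma RtoC_lt (a b : R) : (RtoC a < RtoC b) = (a < b).
Proof. exact: ltcR. Qed.

Lemma RtoC0 : RtoC 0 = 0 :> C. Proof. by []. Qed.

Lemma RtoC1 : RtoC 1 = 1 :> C. Proof. by []. Qed.

Lemma RtoCD (a b : R) : RtoC (a + b) = RtoC a + RtoC b.
Proof. exact: (rmorphD (real_complex R) a b). Qed.

Lemma RtoCM (a b : R) : RtoC (a * b) = RtoC a * RtoC b.
Proof. exact: (rmorphM (real_complex R) a b). Qed.

Lemma RtoC_inj : injective (@RtoC R).
Proof. exact: complexI. Qed.

Lemma nm_ge0 (V : normedModType C) (x : V) : 0 <= nm x.
Proof. by rewrite -RtoC_le -nmE RtoC0. Qed.

Lemma nmD (V : normedModType C) (x y : V) : nm (x + y) <= nm x + nm y.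
Proof. by rewrite -RtoC_le RtoCD -!nmE ler_normD. Qed.

Lemma nmN (V : normedModType C) (x : V) : nm (- x) = nm x.
Proof. by rewrite /nm normrN. Qed.

Lemma nmBC (V : normedModType C) (x y : V) : nm (x - y) = nm (y - x).
Proof. by rewrite /nm distrC. Qed.

Lemma nmZ (V : normedModType C) (a : C) (x : V) : nm (a *: x) = nm a * nm x.
Proof. by apply: RtoC_inj; rewrite RtoCM -!nmE normrZ. Qed.

Lemma nmM (a b : C) : nm (a * b) = nm a * nm b.
Proof. exact: nmZ. Qed.

Lemma nm0 (V : normedModType C) : nm (0 : V) = 0.
Proof. by rewrite /nm normr0. Qed.

Lemma nm_eq0 (V : normedModType C) (x : V) : (nm x == 0) = (x == 0).
Proof. by rewrite -[x == 0]normr_eq0 nmE -RtoC0 (inj_eq RtoC_inj). Qed.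

Lemma nm_gt0 (V : normedModType C) (x : V) : (0 < nm x) = (x != 0).
Proof. by rewrite lt_def nm_ge0 andbT nm_eq0. Qed.

Lemma nmR (a : R) : 0 <= a -> nm (RtoC a : C) = a.
Proof.
by move=> a0; apply: RtoC_inj; rewrite -nmE ger0_norm // -RtoC0 RtoC_le.
Qed.

Lemma nm_rtr (V : normedModType C) (x y z : V) :
  nm (x - z) <= nm (x - y) + nm (y - z).
Proof. by apply: le_trans (nmD _ _); rewrite addrA subrK. Qed.

Lemma inDE (z : C) : inD z = (nm z < 1) :> Prop.
Proof. by rewrite /inD nmE -RtoC1 RtoC_lt. Qed.

Lemma RtoC_gt0P (e : C) : 0 < e -> exists2 r : R, 0 < r & e = RtoC r.
Proof.
move=> e0; exists (nm e); first by rewrite nm_gt0 gt_eqF.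
by rewrite -nmE gtr0_norm.
Qed.

Lemma nbhs_nmP (V : normedModType C) (x : V) (P : set V) :
  nbhs x P <-> exists2 d : R, 0 < d & forall y, nm (y - x) < d -> P y.
Proof.
split.
  move=> /nbhs_normP[e /= /RtoC_gt0P[d d0 ->] H]; exists d => // y yd.
  by apply: H => /=; rewrite distrC nmE RtoC_lt.
move=> [d d0 H]; apply/nbhs_normP; exists (RtoC d).
  by rewrite /= -RtoC0 RtoC_lt.
by move=> y /=; rewrite distrC nmE RtoC_lt; apply: H.
Qed.

Lemma continuous_nmP (V W : normedModType C) (f : V -> W) (x : V) :
  {for x, continuous f} <->
  forall e : R, 0 < e -> exists2 d : R, 0 < d &
    forall y, nm (y - x) < d -> nm (f y - f x) < e.
Proof.
split.
  move=> cf e e0.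
  have /cf : nbhs (f x) [set w : W | nm (w - f x) < e].
    by apply/nbhs_nmP; exists e.
  by move=> /nbhs_nmP.
move=> H P /nbhs_nmP[e e0 He]; have [d d0 Hd] := H _ e0.
by apply/nbhs_nmP; exists d => // y yd; apply/He/Hd.
Qed.

End RealNorm.

(** * The uniform boundedness principle *)

Section UniformBoundedness.
Variables (R : realType) (X : completeNormedModType (Cx R)) (I : Type).
Variable L : I -> X -> Cx R.
Hypothesis Llin : forall i (a : Cx R) x y, L i (a *: x + y) = a * L i x + L i y.
Hypothesis Lcont : forall i, continuous (L i).
Hypothesis Lbnd : forall x, exists M : R, forall i, nm (L i x) <= M.

Let LB i x y : L i (x - y) = L i x - L i y.
Proof. by rewrite addrC -scaleN1r Llin mulN1r addrC. Qed.

(** A pair encodes a ball by centre and radius. Some [L i] exceeds [M] at a point of the half-size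
    ball, and by continuity it still does so on a small closed ball around that point. *)
Let shrink (c : X * R) (M : R) : 0 < c.2 ->
  ~ (forall i y, nm (y - c.1) <= c.2 / 2 -> nm (L i y) <= M) ->
  exists d : X * R, exists i, [/\ 0 < d.2, d.2 <= c.2 / 2,
    nm (d.1 - c.1) + d.2 <= c.2 & forall z, nm (z - d.1) <= d.2 -> M < nm (L i z)].
Proof.
case: c => x r /= r0 /existsNP[i /existsNP[y]] /not_implyP[yx /negP].
rewrite -ltNge => My.
have e0 : 0 < nm (L i y) - M by rewrite subr_gt0.
have /continuous_nmP/(_ _ e0)[d d0 Hd] : {for y, continuous (L i)} by exact: Lcont.
(* Half of [d] puts the closed ball inside the open one given by continuity; [r / 2] keeps it inside
   the old ball. *)
exists (y, Num.min (d / 2) (r / 2)), i => /=; split.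
- by rewrite lt_min !divr_gt0.
- by rewrite ge_min lexx orbT.
- by have : Num.min (d / 2) (r / 2) <= r / 2 by [rewrite ge_min lexx orbT|]; lra.
- move=> z; rewrite le_min => /andP[zd _].
  have /Hd : nm (z - y) < d by lra.
  have := nmD (L i z) (L i y - L i z).
  by rewrite addrC subrK nmBC; lra.
Qed.

(** Otherwise there would be nested closed balls with radii tending to [0] such that some [L i]
    exceeds [n] on the ball of index [n + 1]. By completeness they share a point, and the family
    would be unbounded there. *)
Let locally_bounded : exists x : X, exists2 r : R, 0 < r & exists M : R,
  forall i y, nm (y - x) <= r -> nm (L i y) <= M.
Proof.
apply: contrapT => H.
have step (nc : nat * (X * R)) : exists d : X * R, 0 < nc.2.2 ->
    [/\ 0 < d.2, d.2 <= nc.2.2 / 2, nm (d.1 - nc.2.1) + d.2 <= nc.2.2 &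
     exists i, forall z, nm (z - d.1) <= d.2 -> nc.1%:R < nm (L i z)].
  case: nc => n c /=.
  (* A radius that is not positive never arises in the sequence; the value [c] only makes the choice
     total. *)
  have [c0|c0] := pselect (0 < c.2); last by exists c.
  have [] := @shrink c n%:R c0.
    by move=> K; apply: H; exists c.1, (c.2 / 2); [lra|]; exists n%:R.
  by move=> d [i [? ? ? ?]]; exists d => _; split=> //; exists i.
have [g Hg] := choice step.
pose fix cr n := if n is p.+1 then g (p, cr p) else (0, 1).
have crS n : cr n.+1 = g (n, cr n) by [].
have r_gt0 n : 0 < (cr n).2.
  by elim: n => [|n IH] //; rewrite crS; have [] := Hg (n, cr n) IH.
have r_le n : (cr n).2 <= 2^-1 ^+ n.
  elim: n => [|n IH] //; have [_ h _ _] := Hg (n, cr n) (r_gt0 n).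
  by rewrite crS exprS; apply: le_trans h _ => /=; lra.
have nested n k : nm ((cr (n + k)%N).1 - (cr n).1) + (cr (n + k)%N).2 <= (cr n).2.
  elim: k => [|k IH]; first by rewrite addn0 subrr nm0 add0r.
  have [_ _ h _] := Hg ((n + k)%N, cr (n + k)%N) (r_gt0 _).
  have := nm_rtr (cr (n + k.+1)%N).1 (cr (n + k)%N).1 (cr n).1.
  by move: h; rewrite addnS crS /=; lra.
have small (e : R) : 0 < e -> exists n, (cr n).2 < e.
  move=> e0; have [n _ Hn] := near_infty_natSinv_expn_lt (PosNum e0).
  exists n; apply: le_lt_trans (r_le n) _; have := Hn n (leqnn n).
  by rewrite /= div1r exprVn.
have : cvg ((fun n => (cr n).1) @ \oo)%classic.
  apply/cauchy_cvgP/cauchy_exP => _ /RtoC_gt0P[e e0 ->].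
  have [n rn] := small _ e0; exists (cr n).1, n => // m /= nm'.
  rewrite -ball_normE /= distrC nmE RtoC_lt -(subnKC nm').
  have := nested n (m - n)%N; have := r_gt0 (n + (m - n))%N; lra.
move=> /cvg_ex[l /= cl].
have lball n : nm (l - (cr n).1) <= (cr n).2.
  apply/ler_addgt0Pr => e e0.
  have /cl[k _ Hk] : nbhs l [set y : X | nm (y - l) < e] by apply/nbhs_nmP; exists e.
  have := Hk (n + k)%N (leq_addl _ _); have := nested n k; have := r_gt0 (n + k)%N.
  have := nm_rtr l (cr (n + k)%N).1 (cr n).1; rewrite [X in _ <= X + _]nmBC /=; lra.
have [M HM] := Lbnd l.
(* An integer above [M]: on the ball of the next index, which contains [l], some [L i] exceeds that
   integer. *)
have MN : M < (Num.bound `|M|)%:R.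
  exact: le_lt_trans (ler_norm _) (archi_boundP (normr_ge0 _)).
have [_ _ _ [i Hi]] := Hg (Num.bound `|M|, _) (r_gt0 (Num.bound `|M|)).
have := Hi l (lball (Num.bound `|M|).+1); have := HM i; rewrite /=; lra.
Qed.

(** Scaling [x] to length [r] and adding it to [x0] stays in the ball of [locally_bounded]; the
    values there and at [x0] differ by at most [2 * M]. *)
Lemma uniform_boundedness : exists M : R, forall i x, nm (L i x) <= M * nm x.
Proof.
have [x0 [r r0 [M HM]]] := locally_bounded.
exists (2 * M / r) => i x.
have [->|x_neq0] := eqVneq x 0.
  have -> : L i 0 = 0 by rewrite -[X in L i X](subrr x0) LB subrr.
  by rewrite !nm0 mulr0.
have nx : 0 < nm x by rewrite nm_gt0.
have k0 : 0 < r / nm x by rewrite divr_gt0.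
have /(HM i) : nm ((RtoC (r / nm x) *: x + x0) - x0) <= r.
  by rewrite addrK nmZ nmR ?(ltW k0) // divfK ?gt_eqF.
have /(HM i) : nm (x0 - x0) <= r by rewrite subrr nm0 ltW.
move=> h1; rewrite Llin => h2.
have := nmD (RtoC (r / nm x) * L i x + L i x0) (- L i x0).
rewrite addrK nmN nmM nmR ?(ltW k0) // => h3.
have : r / nm x * nm (L i x) <= 2 * M by lra.
rewrite mulrAC ler_pdivrMr // => h4.
by rewrite mulrAC ler_pdivlMr // mulrC.
Qed.

End UniformBoundedness.

(** * Rectangles and integrals *)

Section Bisection.
Variable R : realType.

Lemma nested_intervals (a b : nat -> R) :
  (forall n, a n <= a n.+1) -> (forall n, b n.+1 <= b n) ->
  (forall n, a n <= b n) -> exists x, forall n, a n <= x <= b n.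
Proof.
move=> ha hb hab.
have ma n k : a n <= a (n + k)%N.
  by elim: k => [|k IH]; rewrite ?addn0 // addnS (le_trans IH).
have mb n k : b (n + k)%N <= b n.
  by elim: k => [|k IH]; rewrite ?addn0 // addnS (le_trans (hb _)).
have ub n : ubound (range a) (b n).
  move=> _ [m _ <-]; apply: le_trans (ma m n) _; apply: le_trans (hab _) _.
  by rewrite addnC.
exists (sup (range a)) => n; apply/andP; split.
  by apply: ub_le_sup; [exists (b 0%N)|exists n].
by apply: ge_sup => //; exists (a 0%N), 0%N.
Qed.

(** If [P] failed, repeated halving would give nested rectangles on which it fails, shrinking to a
    point, against the last hypothesis. This induction principle serves both for Goursat's lemma and
    for boundedness on discs. *)
Lemma rect_bisection (P : R -> R -> R -> R -> Prop) (a0 b0 c0 d0 : R) :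
  a0 <= b0 -> c0 <= d0 ->
  (forall a b c d, a0 <= a -> a <= b -> b <= b0 -> c0 <= c -> c <= d -> d <= d0 ->
    let m := (a + b) / 2 in let n := (c + d) / 2 in
    P a m c n -> P m b c n -> P a m n d -> P m b n d -> P a b c d) ->
  (forall x y, a0 <= x <= b0 -> c0 <= y <= d0 -> exists2 e : R, 0 < e &
    forall a b c d, a0 <= a -> a <= x <= b -> b <= b0 ->
      c0 <= c -> c <= y <= d -> d <= d0 -> b - a < e -> d - c < e -> P a b c d) ->
  P a0 b0 c0 d0.
Proof.
move=> ab0 cd0 Psplit Ploc; apply: contrapT => nP0.
pose bad (s : R * R * (R * R)) := [/\ a0 <= s.1.1, s.1.1 <= s.1.2, s.1.2 <= b0,
  (c0 <= s.2.1 /\ s.2.1 <= s.2.2 /\ s.2.2 <= d0) & ~ P s.1.1 s.1.2 s.2.1 s.2.2].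
pose half (s t : R * R * (R * R)) := [/\ s.1.1 <= t.1.1, t.1.2 <= s.1.2,
  s.2.1 <= t.2.1, t.2.2 <= s.2.2 &
  t.1.2 - t.1.1 = (s.1.2 - s.1.1) / 2 /\ t.2.2 - t.2.1 = (s.2.2 - s.2.1) / 2].
have step s : exists t, bad s -> bad t /\ half s t.
  have [bs|nbs] := pselect (bad s); last by exists s.
  move: bs => [+ + + [+ [+ +]]]; case: s => -[a b] [c d] /= aa ab bb cc cd dd nP.
  pose m := (a + b) / 2; pose n := (c + d) / 2.
  have hm : m = (a + b) / 2 by []. have hn : n = (c + d) / 2 by [].
  have [P1|n1] := pselect (P a m c n); last first.
    by exists (a, m, (c, n)) => _; split; split => //=; (try (repeat split)); lra.
  have [P2|n2] := pselect (P m b c n); last first.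
    by exists (m, b, (c, n)) => _; split; split => //=; (try (repeat split)); lra.
  have [P3|n3] := pselect (P a m n d); last first.
    by exists (a, m, (n, d)) => _; split; split => //=; (try (repeat split)); lra.
  have [P4|n4] := pselect (P m b n d); last first.
    by exists (m, b, (n, d)) => _; split; split => //=; (try (repeat split)); lra.
  by exfalso; apply: nP; apply: Psplit.
have [g Hg] := choice step.
pose s n := iter n g (a0, b0, (c0, d0)).
have bad_s n : bad (s n).
  by elim: n => [|n /Hg[]] //=; split.
have half_s n : half (s n) (s n.+1) by have [] := Hg _ (bad_s n).
have [|||x Hx] := @nested_intervals (fun n => (s n).1.1) (fun n => (s n).1.2).
- by move=> n; have [] := half_s n.
- by move=> n; have [] := half_s n.
- by move=> n; have [] := bad_s n.
have [|||y Hy] := @nested_intervals (fun n => (s n).2.1) (fun n => (s n).2.2).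
- by move=> n; have [] := half_s n.
- by move=> n; have [] := half_s n.
- by move=> n; have [_ _ _ [_ []]] := bad_s n.
have [e e0 He] := Ploc x y (Hx 0%N) (Hy 0%N).
have width n : (s n).1.2 - (s n).1.1 = (b0 - a0) * 2^-1 ^+ n /\
    (s n).2.2 - (s n).2.1 = (d0 - c0) * 2^-1 ^+ n.
  elim: n => [|n [IH1 IH2]]; first by rewrite !expr0 !mulr1.
  by have [_ _ _ _ [-> ->]] := half_s n; rewrite IH1 IH2 exprS; split; ring.
(* The [1] keeps the divisor positive when the rectangle degenerates to a point. *)
have W0 : 0 < (b0 - a0) + (d0 - c0) + 1 by lra.
have eW : 0 < e / ((b0 - a0) + (d0 - c0) + 1) by rewrite divr_gt0.
have [n _ Hn] := near_infty_natSinv_expn_lt (PosNum eW).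
have := Hn n (leqnn n); rewrite /= div1r -exprVn ltr_pdivlMr // => small.
have pn : 0 < 2^-1 ^+ n :> R by rewrite exprn_gt0.
have [w1 w2] := width n; have [? ? ? [? [? ?]]] := bad_s n.
apply; apply: He => //; rewrite ?w1 ?w2.
  by apply: le_lt_trans small; rewrite mulrC ler_pM2l //; lra.
by apply: le_lt_trans small; rewrite mulrC ler_pM2l //; lra.
Qed.

End Bisection.

(** * Integrals of continuous functions over an interval *)

Section Integral.
Variable R : realType.
Implicit Types (g F : R -> R) (a b : R).

Definition itg g a b : R := \int[lebesgue_measure]_(x in `[a, b]) g x.

(** Clamping the argument to [[a, b]] makes [g] continuous on the whole line, so that the primitive
    has a two-sided derivative at the end points as well. *)
Lemma primitive_exists g a b : (forall x, a <= x <= b -> {for x, continuous g}) ->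
  a <= b -> exists F, forall x, a <= x <= b -> is_derive x 1 F (g x).
Proof.
move=> cg ab.
pose cl (x : R) := Num.max a (Num.min b x).
have cl_id x : a <= x <= b -> cl x = x.
  by move=> /andP[ax xb]; rewrite /cl min_r // max_r.
have cl_in x : a <= cl x <= b.
  by rewrite /cl le_max lexx /= ge_max ab /= ge_min lexx.
have ccl : continuous cl.
  move=> x; apply: (@continuous_max _ _ (cst a) (fun x => Num.min b x)).
    exact: cvg_cst.
  by apply: (@continuous_min _ _ (cst b) id); [exact: cvg_cst|exact: cvg_id].
have cgc : continuous (g \o cl).
  by move=> x; apply: continuous_comp; [exact: ccl|exact: cg].
(* Starting at [a - 1] makes every point of [[a, b]], also [a], interior to the range of
   integration. *)
exists (fun x => \int[lebesgue_measure]_(t in `[a - 1, x]) (g \o cl) t) => x xab.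
have [||||h1 h2] := @continuous_FTC1_closed R (g \o cl) (a - 1) x (x + 1).
- by rewrite ltrDl.
- apply: continuous_compact_integrable; first exact: segment_compact.
  exact: continuous_subspaceT.
- by case/andP: xab => ? ?; lra.
- exact: cgc.
by apply: DeriveDef => //; rewrite -derive1E h2 /= cl_id.
Qed.

Lemma itgE g F a b : a <= b -> (forall x, a <= x <= b -> {for x, continuous g}) ->
  (forall x, a <= x <= b -> is_derive x 1 F (g x)) -> itg g a b = F b - F a.
Proof.
rewrite le_eqVlt => /predU1P[->|ab] cg dF.
  by rewrite /itg set_itv1 Rintegral_set1 subrr.
rewrite /itg /Rintegral.
have cF x : a <= x <= b -> {for x, continuous F}.
  by move=> /dF dx; apply/differentiable_continuous/derivable1_diffP.
rewrite (@continuous_FTC2 _ g F a b ab) //.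
- by apply: continuous_in_subspaceT => x; rewrite inE /= in_itv /=; exact: cg.
- split.
  + by move=> x; rewrite in_itv /= => /andP[ax xb]; have := dF x; rewrite !ltW // => /(_ isT)[].
  + by apply: cvg_at_right_filter; apply: cF; rewrite lexx ltW.
  + by apply: cvg_at_left_filter; apply: cF; rewrite lexx ltW.
- move=> x; rewrite in_itv /= => /andP[ax xb]; rewrite derive1E.
  by have := dF x; rewrite !ltW // => /(_ isT)[_ ->].
Qed.

Lemma itg_split g a m b : a <= m -> m <= b ->
  (forall x, a <= x <= b -> {for x, continuous g}) ->
  itg g a b = itg g a m + itg g m b.
Proof.
move=> am mb cg; have [F HF] := primitive_exists cg (le_trans am mb).
have ab := le_trans am mb.
have sub1 x : a <= x <= m -> a <= x <= b by move=> /andP[-> /le_trans->].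
have sub2 x : m <= x <= b -> a <= x <= b by move=> /andP[/(le_trans am)-> ->].
rewrite (itgE ab cg HF) (itgE am (fun x h => cg x (sub1 x h)) (fun x h => HF x (sub1 x h))).
rewrite (itgE mb (fun x h => cg x (sub2 x h)) (fun x h => HF x (sub2 x h))); ring.
Qed.

(** This is the mean value theorem for [G - F], with [G] a primitive of [g]. It takes the place of
    monotonicity of the integral: a constant [F] gives signs, a quadratic [F] the comparison with
    affine functions. *)
Lemma itg_mvt g h F a b : a <= b ->
  (forall x, a <= x <= b -> {for x, continuous g}) ->
  (forall x, a <= x <= b -> is_derive x 1 F (h x)) ->
  exists2 x, a <= x <= b & itg g a b - (F b - F a) = (g x - h x) * (b - a).
Proof.
move=> ab cg dF; have [G HG] := primitive_exists cg ab.
have dGF x : a <= x <= b -> is_derive x 1 (G - F) (g x - h x).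
  by move=> xab; apply: is_deriveB; [exact: HG|exact: dF].
have [||c cab E] := @MVT_segment R (G - F) (fun x => g x - h x) a b ab.
- by move=> x; rewrite in_itv /= => /andP[? ?]; apply: dGF; apply/andP; split; lra.
- apply: continuous_in_subspaceT => x; rewrite inE /= in_itv /= => /dGF dx.
  by apply/differentiable_continuous/derivable1_diffP.
exists c; first by move: cab; rewrite in_itv.
by rewrite -E (itgE ab cg HG) /= !fctE; ring.
Qed.

Lemma itg_gt0 g a b : a < b -> (forall x, a <= x <= b -> {for x, continuous g}) ->
  (forall x, a <= x <= b -> 0 < g x) -> 0 < itg g a b.
Proof.
move=> ab cg g0.
have d0 x : a <= x <= b -> is_derive x 1 (cst (0 : R)) ((cst 0 : R -> R) x).
  by move=> _; exact: is_derive_cst.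
have [x xab] := itg_mvt (ltW ab) cg d0.
by rewrite /cst !subr0 => ->; rewrite mulr_gt0 ?g0 ?subr_gt0.
Qed.

Lemma itg_lt0 g a b : a < b -> (forall x, a <= x <= b -> {for x, continuous g}) ->
  (forall x, a <= x <= b -> g x < 0) -> itg g a b < 0.
Proof.
move=> ab cg g0.
have d0 x : a <= x <= b -> is_derive x 1 (cst (0 : R)) ((cst 0 : R -> R) x).
  by move=> _; exact: is_derive_cst.
have [x xab] := itg_mvt (ltW ab) cg d0.
by rewrite /cst !subr0 => ->; rewrite pmulr_llt0 ?g0 ?subr_gt0.
Qed.

End Integral.

(** * Goursat's lemma for a closed form *)

Section ClosedForm.
Variable R : realType.
Variables p q : R -> R -> R.

(** The integral of [p dx + q dy] along the boundary of [[a, b] x [c, d]], counterclockwise. *)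
Definition circ a b c d : R :=
  itg (p ^~ c) a b + itg (q b) c d - itg (p ^~ d) a b - itg (q a) c d.

(* Total differentiability of [p] and [q] at [(x, y)] with [p_y = q_x]: the form
   [p dx + q dy] is closed there, but no continuity of the derivatives is asked. *)
Definition closed_at (x y : R) := exists p1 k q2 : R,
  forall e : R, 0 < e -> exists2 dl : R, 0 < dl & forall s t : R,
    `|s| < dl -> `|t| < dl ->
    `|p (x + s) (y + t) - (p x y + p1 * s + k * t)| <= e * (`|s| + `|t|) /\
    `|q (x + s) (y + t) - (q x y + k * s + q2 * t)| <= e * (`|s| + `|t|).

Lemma continuous_ptP (g : R -> R) (x : R) :
  (exists l : R, exists2 dl : R, 0 < dl & forall s : R,
     `|s| < dl -> `|g (x + s) - (g x + l * s)| <= `|s|) ->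
  {for x, continuous g}.
Proof.
move=> [l [dl dl0 H]]; apply/cvgrPdist_lt => e e0.
have l1 : 0 < `|l| + 1 by rewrite ltr_wpDl.
near=> t.
have ts : `|t - x| < dl.
  by rewrite distrC; near: t; apply: cvgr_dist_lt => //; exact: cvg_id.
have te : `|t - x| * (`|l| + 1) < e.
  rewrite -ltr_pdivlMr // distrC; near: t.
  by apply: cvgr_dist_lt; [exact: cvg_id|rewrite divr_gt0].
have := H _ ts; rewrite [x + _]addrC subrK => h.
have := ler_normD (g t - (g x + l * (t - x))) (l * (t - x)).
rewrite normrM [`|g x - g t|]distrC.
have -> : g t - (g x + l * (t - x)) + l * (t - x) = g t - g x by ring.
lra.
Unshelve. all: by end_near. Qed.

Lemma closed_at_continuous x y : closed_at x y ->
  {for x, continuous (p ^~ y)} /\ {for y, continuous (q x)}.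
Proof.
move=> [p1 [k [q2 /(_ 1 ltr01)[dl dl0 H]]]]; split; apply: continuous_ptP.
  exists p1, dl => // s sd; have [|+ _] := H s 0 sd; first by rewrite normr0.
  by rewrite addr0 mulr0 addr0 normr0 addr0 mul1r.
exists q2, dl => // s sd; have [| |_] := H 0 s; [by rewrite normr0|by []|].
by rewrite addr0 mulr0 addr0 normr0 add0r mul1r.
Qed.

Lemma is_derive_quadratic (B K x : R) :
  is_derive x 1 (fun t => B * t + K * t ^+ 2) (B + 2 * K * x).
Proof.
have d1 := is_deriveZ B (is_derive_id x (1 : R)).
have d2 := is_deriveZ K (is_deriveX 2 (is_derive_id x (1 : R))).
have d := is_deriveD d1 d2.
have -> : B + 2 * K * x = B *: (1:R) + K *: ((2%:R * x ^+ 1) *: (1:R)) :> R.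
  rewrite /GRing.scale /= expr1 !mulr1; ring.
exact: d.
Qed.

(** The subtracted term is the exact integral of [A + B * x], so [itg_mvt] turns the difference into
    one value of the error times [b - a]. *)
Lemma itg_affine (g : R -> R) (A B e a b : R) : a <= b ->
  (forall x, a <= x <= b -> {for x, continuous g}) ->
  (forall x, a <= x <= b -> `|g x - (A + B * x)| <= e) ->
  `|itg g a b - ((A * b + B / 2 * b ^+ 2) - (A * a + B / 2 * a ^+ 2))| <= e * (b - a).
Proof.
move=> ab cg ge.
have dF x : a <= x <= b ->
    is_derive x 1 (fun t => A * t + B / 2 * t ^+ 2) (A + B * x).
  by move=> _; apply: is_derive_eq (is_derive_quadratic _ _ _) _; lra.
have [x xab ->] := itg_mvt ab cg dF.
by rewrite normrM [X in _ * X]ger0_norm ?subr_ge0 // ler_wpM2r ?subr_ge0 // ge.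
Qed.

Section Goursat.
Variables a0 b0 c0 d0 : R.
Hypothesis ab0 : a0 <= b0.
Hypothesis cd0 : c0 <= d0.
Hypothesis clos : forall x y, a0 <= x <= b0 -> c0 <= y <= d0 -> closed_at x y.

Let cp a b y : a0 <= a -> b <= b0 -> c0 <= y <= d0 ->
  forall x, a <= x <= b -> {for x, continuous (p ^~ y)}.
Proof.
move=> a0a bb0 y0 x /andP[ax xb].
have /clos : a0 <= x <= b0 by apply/andP; split; lra.
by move=> /(_ _ y0)/closed_at_continuous[].
Qed.

Let cq c d x : c0 <= c -> d <= d0 -> a0 <= x <= b0 ->
  forall y, c <= y <= d -> {for y, continuous (q x)}.
Proof.
move=> c0c dd0 x0 y /andP[cy yd].
have y0 : c0 <= y <= d0 by apply/andP; split; lra.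
by have /closed_at_continuous[] := clos x0 y0.
Qed.

(** Goursat's argument. Over the four quarters the circulations add up to that of the whole, and so
    do the squares of the half-perimeters. Near a point the linear parts of [p] and [q] have no
    circulation, and the remainder is small compared with the size of the rectangle. *)
Lemma circ_small (e : R) : 0 < e ->
  `|circ a0 b0 c0 d0| <= e * ((b0 - a0) + (d0 - c0)) ^+ 2.
Proof.
move=> e0.
apply: (@rect_bisection _
  (fun a b c d => `|circ a b c d| <= e * ((b - a) + (d - c)) ^+ 2)) => //.
  move=> a b c d a0a ab bb0 c0c cd dd0 m n.
  have [hm hn] : m = (a + b) / 2 /\ n = (c + d) / 2 by [].
  (* The inner edges are traversed in both directions and cancel. *)
  have -> : circ a b c d = circ a m c n + circ m b c n + circ a m n d + circ m b n d.
    rewrite /circ.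
    rewrite (@itg_split _ (p ^~ c) a m b); [|lra|lra|by apply: cp => //; apply/andP; split; lra].
    rewrite (@itg_split _ (p ^~ d) a m b); [|lra|lra|by apply: cp => //; apply/andP; split; lra].
    rewrite (@itg_split _ (q a) c n d); [|lra|lra|by apply: cq => //; apply/andP; split; lra].
    rewrite (@itg_split _ (q b) c n d); [|lra|lra|by apply: cq => //; apply/andP; split; lra].
    ring.
  have -> : e * ((b - a) + (d - c)) ^+ 2 =
      e * ((m - a) + (n - c)) ^+ 2 + e * ((b - m) + (n - c)) ^+ 2 +
      e * ((m - a) + (d - n)) ^+ 2 + e * ((b - m) + (d - n)) ^+ 2.
    by rewrite hm hn; field.
  move=> h1 h2 h3 h4.
  apply: le_trans (ler_normD _ _) (lerD _ h4).
  apply: le_trans (ler_normD _ _) (lerD _ h3).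
  exact: le_trans (ler_normD _ _) (lerD h1 h2).
move=> x y x0 y0; have [p1 [k [q2 H]]] := clos x0 y0.
(* With [w] the half-perimeter, each side contributes at most [e / 2 * w] times its length, and the
   lengths add up to [2 * w]. *)
have e2 : 0 < e / 2 by lra.
have [dl dl0 {}H] := H _ e2; exists dl => //.
move=> a b c d a0a /andP[ax xb] bb0 c0c /andP[cy yd] dd0 wab wcd.
set w := (b - a) + (d - c).
have near s t : a <= s <= b -> c <= t <= d ->
    `|p s t - (p x y + p1 * (s - x) + k * (t - y))| <= e / 2 * w /\
    `|q s t - (q x y + k * (s - x) + q2 * (t - y))| <= e / 2 * w.
  move=> /andP[as_ sb] /andP[ct td].
  have sx : `|s - x| <= b - a by rewrite ler_norml; apply/andP; split; lra.
  have ty : `|t - y| <= d - c by rewrite ler_norml; apply/andP; split; lra.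
  have [||h1 h2] := H (s - x) (t - y); [lra|lra|].
  have le_w : e / 2 * (`|s - x| + `|t - y|) <= e / 2 * w.
    by rewrite ler_pM2l // /w; lra.
  move: h1 h2; rewrite ![x + _]addrC ![y + _]addrC !subrK => h1 h2.
  by split; [exact: le_trans le_w|exact: le_trans le_w].
have aab : a <= a <= b by apply/andP; split; lra.
have bab : a <= b <= b by apply/andP; split; lra.
have ccd : c <= c <= d by apply/andP; split; lra.
have dcd : c <= d <= d by apply/andP; split; lra.
have x0' z : a <= z <= b -> a0 <= z <= b0 by move=> /andP[? ?]; apply/andP; split; lra.
have y0' z : c <= z <= d -> c0 <= z <= d0 by move=> /andP[? ?]; apply/andP; split; lra.
(* Along a side one variable is fixed, so the linear model is affine in the other; the fixed
   variable goes into the constant term. *)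
have Hp t (tcd : c <= t <= d) :=
  @itg_affine (p ^~ t) (p x y - p1 * x + k * (t - y)) p1 (e / 2 * w) a b
    (le_trans ax xb) (cp a0a bb0 (y0' t tcd)).
have Hq s (sab : a <= s <= b) :=
  @itg_affine (q s) (q x y + k * (s - x) - q2 * y) q2 (e / 2 * w) c d
    (le_trans cy yd) (cq c0c dd0 (x0' s sab)).
have Ep s t : a <= s <= b -> c <= t <= d ->
    `|p s t - (p x y - p1 * x + k * (t - y) + p1 * s)| <= e / 2 * w.
  move=> sab tcd; have [h _] := near s t sab tcd; move: h.
  by congr (`|_| <= _); ring.
have Eq s t : a <= s <= b -> c <= t <= d ->
    `|q s t - (q x y + k * (s - x) - q2 * y + q2 * t)| <= e / 2 * w.
  move=> sab tcd; have [_ h] := near s t sab tcd; move: h.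
  by congr (`|_| <= _); ring.
have := Hp c ccd (fun s sab => Ep s c sab ccd).
have := Hp d dcd (fun s sab => Ep s d sab dcd).
have := Hq a aab (fun t tcd => Eq a t aab tcd).
have := Hq b bab (fun t tcd => Eq b t bab tcd).
rewrite /circ; set J1 := itg _ _ _; set J2 := itg _ _ _.
set J3 := itg _ _ _; set J4 := itg _ _ _.
set D1 := (X in `|_ - X| <= _ -> _); move=> h1.
set D2 := (X in `|_ - X| <= _ -> _); move=> h2.
set D3 := (X in `|_ - X| <= _ -> _); move=> h3.
set D4 := (X in `|_ - X| <= _ -> _); move=> h4.
(* The linear models have zero circulation because the same [k] is both the [y]-slope of [p] and the
   [x]-slope of [q]. *)
have D0 : D4 + D1 - D3 - D2 = 0 by rewrite /D1 /D2 /D3 /D4; field.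
have -> : e * w ^+ 2 = 2 * (e / 2 * w * (b - a)) + 2 * (e / 2 * w * (d - c)).
  by rewrite /w; field.
move: h1 h2 h3 h4; rewrite !ler_norml => /andP[? ?] /andP[? ?] /andP[? ?] /andP[? ?].
by apply/andP; split; lra.
Qed.

Lemma circ_eq0 : circ a0 b0 c0 d0 = 0.
Proof.
apply/eqP; rewrite -normr_eq0 eq_le normr_ge0 andbT; apply/ler_addgt0Pr => e e0.
rewrite add0r; set w := ((b0 - a0) + (d0 - c0)) ^+ 2.
have w1 : 0 < w + 1 by rewrite ltr_wpDl // sqr_ge0.
have e1 : 0 < e / (w + 1) by rewrite divr_gt0.
apply: le_trans (circ_small e1) _.
by rewrite -/w mulrAC ler_pdivrMr // ler_pM2l // lerDl.
Qed.

End Goursat.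
End ClosedForm.

(** * Vanishing circulation around a puncture *)

Section PuncturedSquare.
Variables (R : realType) (p q : R -> R -> R) (rho : R).
Hypothesis rho0 : 0 < rho.
Hypothesis clos : forall x y, - rho <= x <= rho -> - rho <= y <= rho ->
  (x != 0) || (y != 0) -> closed_at p q x y.
Hypothesis residue0 : forall e : R, 0 < e -> exists2 dl : R, 0 < dl &
  forall x y : R, `|x| < dl -> `|y| < dl -> (x != 0) || (y != 0) ->
    `|p x y| * (`|x| + `|y|) <= e /\ `|q x y| * (`|x| + `|y|) <= e.

Let cp a b y : - rho <= a -> b <= rho -> - rho <= y <= rho -> y != 0 ->
  forall x, a <= x <= b -> {for x, continuous (p ^~ y)}.
Proof.
move=> a0a bb0 y0 y_neq0 x /andP[ax xb].
have x0 : - rho <= x <= rho by apply/andP; split; lra.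
have := clos x0 y0; rewrite y_neq0 orbT => /(_ isT).
by move=> /closed_at_continuous[].
Qed.

Let cq c d x : - rho <= c -> d <= rho -> - rho <= x <= rho -> x != 0 ->
  forall y, c <= y <= d -> {for y, continuous (q x)}.
Proof.
move=> c0c dd0 x0 x_neq0 y /andP[cy yd].
have y0 : - rho <= y <= rho by apply/andP; split; lra.
have := clos x0 y0; rewrite x_neq0 => /(_ isT).
by move=> /closed_at_continuous[].
Qed.

Let rect0 a b c d : - rho <= a -> a <= b -> b <= rho ->
  - rho <= c -> c <= d -> d <= rho ->
  (b < 0) || (0 < a) || (d < 0) || (0 < c) -> circ p q a b c d = 0.
Proof.
move=> ? ? ? ? ? ? off; apply: circ_eq0 => // x y /andP[? ?] /andP[? ?].
apply: clos; [by apply/andP; split; lra|by apply/andP; split; lra|].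
apply: contraT; rewrite negb_or !negbK => /andP[/eqP xE /eqP yE].
by move: off => /orP[/orP[/orP[]|]|] ?; lra.
Qed.

(** The frame between the two squares is cut into strips of full width below and above and a block
    on either side. None of the four contains the origin, so their circulations vanish. *)
Let hole s : 0 < s -> s < rho ->
  circ p q (- rho) rho (- rho) rho = circ p q (- s) s (- s) s.
Proof.
move=> s0 srho.
have ns0 : s != 0 by rewrite gt_eqF.
have nNs0 : - s != 0 by rewrite oppr_eq0.
have nr0 : rho != 0 by rewrite gt_eqF.
have nNr0 : - rho != 0 by rewrite oppr_eq0.
have : circ p q (- rho) rho (- rho) (- s) = 0 by apply: rect0; lra.
have : circ p q (- rho) rho s rho = 0 by apply: rect0; lra.
have : circ p q (- rho) (- s) (- s) s = 0 by apply: rect0; lra.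
have : circ p q s rho (- s) s = 0 by apply: rect0; lra.
have split3 g : (forall x, - rho <= x <= rho -> {for x, continuous g}) ->
    itg g (- rho) rho = itg g (- rho) (- s) + (itg g (- s) s + itg g s rho).
  move=> cg; rewrite (@itg_split _ g _ (- s)) //; [|lra|lra].
  congr (_ + _); apply: itg_split; [lra|lra|].
  by move=> x /andP[? ?]; apply: cg; apply/andP; split; lra.
rewrite /circ (split3 (p ^~ s)); last by apply: cp => //; apply/andP; split; lra.
rewrite (split3 (p ^~ (- s))); last by apply: cp => //; apply/andP; split; lra.
rewrite (split3 (q rho)); last by apply: cq => //; apply/andP; split; lra.
rewrite (split3 (q (- rho))); last by apply: cq => //; apply/andP; split; lra.
lra.
Qed.

(** The square can be shrunk around the origin, where [residue0] makes the integrand small compared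
    with the inverse of the side. *)
Lemma circ_punctured_eq0 : circ p q (- rho) rho (- rho) rho = 0.
Proof.
apply/eqP; rewrite -normr_eq0 eq_le normr_ge0 andbT; apply/ler_addgt0Pr => e e0.
(* On the square of half-side [s] the integrand is at most [e / (8 * s)], so each of the four sides,
   of length [2 * s], contributes at most [e / 4]. *)
have e8 : 0 < e / 8 by lra.
have [dl dl0 H] := residue0 e8.
pose s := Num.min dl rho / 2.
have m0 : 0 < Num.min dl rho by rewrite lt_min dl0.
have m1 : Num.min dl rho <= dl by rewrite ge_min lexx.
have m2 : Num.min dl rho <= rho by rewrite ge_min lexx orbT.
have [s0 sdl srho] : [/\ 0 < s, s < dl & s < rho] by rewrite /s; split; lra.
rewrite add0r (hole s0 srho) /circ.
have ns0 : s != 0 by rewrite gt_eqF.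
have nNs0 : - s != 0 by rewrite oppr_eq0.
have ns : `|s| = s by rewrite gtr0_norm.
have bnd g : (forall x, - s <= x <= s -> {for x, continuous g}) ->
    (forall x, - s <= x <= s -> `|g x| * s <= e / 8) -> `|itg g (- s) s| <= e / 4.
  move=> cg gb.
  have Nss : - s <= s by lra.
  have gb' x : - s <= x <= s -> `|g x - (0 + 0 * x)| <= e / 8 / s.
    by move=> /gb h; rewrite mul0r addr0 subr0 ler_pdivlMr.
  have := itg_affine Nss cg gb'; rewrite !mul0r !addr0 !subr0.
  by have -> : e / 8 / s * (s - - s) = e / 4 by field.
have in_dl x : - s <= x <= s -> `|x| < dl.
  by move=> /andP[? ?]; rewrite ltr_norml; apply/andP; split; lra.
have sss : - s <= s <= s by apply/andP; split; lra.
have sNs : - s <= - s <= s by apply/andP; split; lra.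
have weak (u v : R) : 0 <= u -> 0 <= v -> u * s <= u * (s + v) by move=> *; nra.
have Bp y : (y == s) || (y == - s) -> `|itg (p ^~ y) (- s) s| <= e / 4.
  move=> yE; have ny : `|y| = s by case/orP: yE => /eqP ->; rewrite ?normrN.
  have y0 : y != 0 by rewrite -normr_eq0 ny.
  apply: bnd.
    by apply: cp => //; [lra|lra|case/orP: yE => /eqP ->; apply/andP; split; lra].
  move=> x xs; have [|||h _] := H x y; [exact: in_dl|by rewrite ny|by rewrite y0 orbT|].
  by apply: le_trans h; rewrite ny [`|x| + s]addrC weak.
have Bq x : (x == s) || (x == - s) -> `|itg (q x) (- s) s| <= e / 4.
  move=> xE; have nx : `|x| = s by case/orP: xE => /eqP ->; rewrite ?normrN.
  have x0 : x != 0 by rewrite -normr_eq0 nx.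
  apply: bnd.
    by apply: cq => //; [lra|lra|case/orP: xE => /eqP ->; apply/andP; split; lra].
  move=> y ys; have [|||_ h] := H x y; [by rewrite nx|exact: in_dl|by rewrite x0|].
  by apply: le_trans h; rewrite nx weak.
have := Bp s; have := Bp (- s); have := Bq s; have := Bq (- s).
rewrite !eqxx !orbT /= => /(_ isT) + /(_ isT) + /(_ isT) + /(_ isT).
rewrite !ler_norml => /andP[? ?] /andP[? ?] /andP[? ?] /andP[? ?].
by apply/andP; split; lra.
Qed.

End PuncturedSquare.

(** * Cauchy's estimate *)

Section CauchyEstimate.
Variable R : realType.
Local Notation C := (Cx R).
Local Notation Re := (@complex.Re R).
Local Notation Im := (@complex.Im R).

Definition mkC (x y : R) : C := (x +i* y)%C.

Lemma nm_sqr (z : C) : nm z ^+ 2 = Re z ^+ 2 + Im z ^+ 2.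
Proof.
rewrite /nm normc_def /= sqr_sqrtr //; by rewrite addr_ge0 // sqr_ge0.
Qed.

Lemma Re_le_nm (z : C) : `|Re z| <= nm z.
Proof.
rewrite -(@ler_pXn2r _ 2) ?nnegrE ?nm_ge0 // nm_sqr -normrX ger0_norm ?sqr_ge0 //.
by rewrite lerDl sqr_ge0.
Qed.

Lemma Im_le_nm (z : C) : `|Im z| <= nm z.
Proof.
rewrite -(@ler_pXn2r _ 2) ?nnegrE ?nm_ge0 // nm_sqr -normrX ger0_norm ?sqr_ge0 //.
by rewrite lerDr sqr_ge0.
Qed.

Lemma nm_le_ReIm (z : C) : nm z <= `|Re z| + `|Im z|.
Proof.
rewrite -(@ler_pXn2r _ 2) ?nnegrE ?nm_ge0 ?addr_ge0 // nm_sqr.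
rewrite -[Re z ^+ 2]real_normK ?num_real // -[Im z ^+ 2]real_normK ?num_real //.
have := normr_ge0 (Re z); have := normr_ge0 (Im z); nra.
Qed.

Lemma mkC_eq0 (x y : R) : (mkC x y == 0) = (x == 0) && (y == 0).
Proof. exact: eq_complex. Qed.

(** The limit of the difference quotient, multiplied by [h]; in this form [h = 0] is allowed. *)
Lemma derivable_cdiff (g : C -> C) (z : C) : derivable g z 1 ->
  forall e : R, 0 < e -> exists2 d : R, 0 < d & forall h : C, nm h < d ->
    nm (g (z + h) - (g z + derive1 g z * h)) <= e * nm h.
Proof.
move=> dg e e0.
have cv : (fun h => h^-1 *: ((g \o shift z) (h *: 1) - g z)) @ 0^' --> derive1 g z.
  by rewrite derive1E.
have /cv dq : nbhs (derive1 g z) [set w : C | nm (w - derive1 g z) < e].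
  by apply/nbhs_nmP; exists e.
have /nbhs_nmP[d d0 H] : nbhs (0 : C) [set h : C | h != 0 ->
    nm (h^-1 *: ((g \o shift z) (h *: 1) - g z) - derive1 g z) < e] by exact: dq.
exists d => // h hd.
have [->|h0] := eqVneq h 0.
  by rewrite !addr0 mulr0 addr0 subrr !nm0 mulr0.
have := H h; rewrite subr0 => /(_ hd h0) /= /ltW.
have nh : 0 < nm h by rewrite nm_gt0.
rewrite -(ler_pM2r nh) -nmM => K; apply: le_trans K.
rewrite le_eqVlt; apply/orP; left; apply/eqP; congr nm.
rewrite [h *: 1]mulr1 [h + z]addrC mulrBl /GRing.scale /= mulrAC mulVf // mul1r.
by rewrite opprD addrA.
Qed.

(** The form is the imaginary part of [g dz]. The Cauchy-Riemann equations make it closed: [Re l] is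
    the common cross slope. *)
Lemma derivable_closed_at (g : C -> C) (x y : R) : derivable g (mkC x y) 1 ->
  closed_at (fun s t => Im (g (mkC s t))) (fun s t => Re (g (mkC s t))) x y.
Proof.
move=> /derivable_cdiff H; set l := derive1 g _ in H.
exists (Im l), (Re l), (- Im l) => e e0; have [d d0 {}H] := H e e0.
exists (d / 2); first by rewrite divr_gt0.
move=> s t sd td; have nst := nm_le_ReIm (mkC s t).
have h : nm (mkC s t) < d by move: nst; rewrite /=; lra.
have := H _ h; rewrite (_ : mkC x y + mkC s t = mkC (x + s) (y + t)) // => {}H.
have {}H : nm (g (mkC (x + s) (y + t)) - (g (mkC x y) + l * mkC s t)) <=
    e * (`|s| + `|t|) by apply: le_trans H _; rewrite ler_pM2l.
split.
  apply: le_trans H; apply: le_trans (Im_le_nm _).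
  rewrite le_eqVlt; apply/orP; left; apply/eqP; congr `|_|.
  by case: (g _) => a b; case: (g _) => a' b'; case: (l) => l1 l2 /=; ring.
apply: le_trans H; apply: le_trans (Re_le_nm _).
rewrite le_eqVlt; apply/orP; left; apply/eqP; congr `|_|.
by case: (g _) => a b; case: (g _) => a' b'; case: (l) => l1 l2 /=; ring.
Qed.

Lemma derivable_shift (f : C -> C) (w z : C) :
  derivable f (w + z) 1 -> derivable (fun u => f (w + u)) z 1.
Proof.
move=> df; rewrite /derivable.
have -> : (fun h : C => h^-1 *: (((fun u => f (w + u)) \o shift z) (h *: 1) - f (w + z)))
    = (fun h => h^-1 *: ((f \o shift (w + z)) (h *: 1) - f (w + z))).
  by apply/funext => h /=; rewrite addrCA.
exact: df.
Qed.

Lemma Re_inv_mkC (x y : R) : Re (mkC x y)^-1 = x / (x ^+ 2 + y ^+ 2).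
Proof. by []. Qed.

Lemma Im_inv_mkC (x y : R) : Im (mkC x y)^-1 = - (y / (x ^+ 2 + y ^+ 2)).
Proof. by []. Qed.

Lemma ReD (a b : C) : Re (a + b) = Re a + Re b.
Proof. by case: a b => [? ?] [? ?]. Qed.

Lemma ImD (a b : C) : Im (a + b) = Im a + Im b.
Proof. by case: a b => [? ?] [? ?]. Qed.

Lemma addr_mkC0 (w : C) : w + mkC 0 0 = w.
Proof. exact: addr0. Qed.

Section Estimate.
Variables (f : C -> C) (w : C) (rho M : R).
Hypothesis rho0 : 0 < rho.
Hypothesis df : forall x y : R, - rho <= x <= rho -> - rho <= y <= rho ->
  derivable f (w + mkC x y) 1.
Hypothesis fM : forall x y : R, - rho <= x <= rho -> - rho <= y <= rho ->
  nm (f (w + mkC x y)) <= M.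

Let l : C := derive1 f w.
(* Away from [0] this is [1 / z - (f (w + z) - f w) / (l * z ^+ 2)]; the linear
   term makes [z * G z] vanish at [0], so that [0] contributes no residue. *)
Let G (z : C) : C := (f (w + z) - (f w + l * z)) * (z ^+ 2)^-1 * (- l)^-1.
Let p (x y : R) := Im (G (mkC x y)).
Let q (x y : R) := Re (G (mkC x y)).

Let Gclosed (x y : R) : - rho <= x <= rho -> - rho <= y <= rho ->
  (x != 0) || (y != 0) -> closed_at p q x y.
Proof.
move=> hx hy xy0; apply: derivable_closed_at.
have z0 : mkC x y != 0 by rewrite mkC_eq0 negb_and.
have d1 : derivable (fun z : C => f (w + z) - (f w + l * z)) (mkC x y) 1.
  apply: derivableB; first exact/derivable_shift/df.
  apply: derivableD; first exact: derivable_cst.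
  exact: (@derivableZ C C C id l (mkC x y) 1 (@derivable_id C C (mkC x y) 1)).
have d2 : derivable (fun z : C => (z ^+ 2)^-1) (mkC x y) 1.
  apply: derivableV; first by rewrite expf_neq0.
  exact: (@derivableX C C id 2 (mkC x y) 1 (@derivable_id C C (mkC x y) 1)).
exact: (derivableM (derivableM d1 d2) (@derivable_cst C C C (- l)^-1 (mkC x y) 1)).
Qed.

Let rho_in : - rho <= 0 <= rho.
Proof. by rewrite oppr_le0 ltW. Qed.

(** Up to sign, [z * G z] is the first-order error of [f] at [w] divided by [l * z], hence tends to
    [0]. *)
Let Gresidue : l != 0 -> forall e : R, 0 < e -> exists2 dl : R, 0 < dl &
  forall x y : R, `|x| < dl -> `|y| < dl -> (x != 0) || (y != 0) ->
    `|p x y| * (`|x| + `|y|) <= e /\ `|q x y| * (`|x| + `|y|) <= e.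
Proof.
move=> l0 e e0; have nl : 0 < nm l by rewrite nm_gt0.
(* The factor [nm l] undoes the division by [l]; the [2] comes from bounding the sum of the absolute
   values of [x] and [y] by [2 * nm z]. *)
have e1 : 0 < e * nm l / 2 by rewrite divr_gt0 // mulr_gt0.
have dfw : derivable f w 1.
  by have := df rho_in rho_in; rewrite addr_mkC0.
have [d d0 H] := derivable_cdiff dfw e1.
exists (d / 2); first by rewrite divr_gt0.
move=> x y xd yd xy0; set z := mkC x y.
have z0 : z != 0 by rewrite mkC_eq0 negb_and.
have nz : 0 < nm z by rewrite nm_gt0.
have zd : nm z < d by have := nm_le_ReIm z; rewrite /=; lra.
have xz : `|x| <= nm z := Re_le_nm z.
have yz : `|y| <= nm z := Im_le_nm z.
have Gz : nm (G z) * (2 * nm z) <= e.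
  have GE : G z * (z * z * - l) = f (w + z) - (f w + l * z).
    by rewrite /G; field; rewrite z0 l0.
  have := H z zd; rewrite -/l -GE; move: (G z) => g; rewrite !nmM nmN => K.
  have : nm g * (2 * nm z) * (nm z * nm l) <= e * (nm z * nm l) by lra.
  by rewrite ler_pM2r // mulr_gt0.
have G0 := nm_ge0 (G z).
by split; apply: le_trans Gz; apply: ler_pM => //;
  rewrite ?addr_ge0 //; [exact: Im_le_nm|lra|exact: Re_le_nm|lra].
Qed.

(** Here [nm z >= rho], so the error has norm at most [2 * M / (nm l * rho ^+ 2)], and
    [4 * M / rho < nm l] makes this less than [1 / (2 * rho)]. *)
Let Gboundary (x y : R) : - rho <= x <= rho -> - rho <= y <= rho ->
  (`|x| == rho) || (`|y| == rho) -> 4 * M / rho < nm l ->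
  exists2 k : C, G (mkC x y) = (mkC x y)^-1 + k & nm k < (2 * rho)^-1.
Proof.
move=> hx hy bd lM; set z := mkC x y.
have M0 : 0 <= M by apply: le_trans (nm_ge0 _) (fM hx hy).
have nl : 0 < nm l by apply: le_lt_trans lM; rewrite divr_ge0 ?mulr_ge0 // ltW.
have l0 : l != 0 by rewrite -nm_gt0.
have rz : rho <= nm z.
  by case/orP: bd => /eqP <-; [exact: (Re_le_nm z)|exact: (Im_le_nm z)].
have nz : 0 < nm z by apply: lt_le_trans rz.
have z0 : z != 0 by rewrite -nm_gt0.
exists ((f w - f (w + z)) / (l * z ^+ 2)).
  by rewrite /G; field; rewrite z0 l0.
set k := _ / _.
have kE : k * (l * (z * z)) = f w - f (w + z).
  by rewrite /k; field; rewrite z0 l0.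
have : nm (k * (l * (z * z))) <= 2 * M.
  rewrite kE; apply: le_trans (nmD _ _) _; rewrite nmN.
  have := fM hx hy; have := fM rho_in rho_in.
  by rewrite -/z addr_mkC0; lra.
move: k {kE} => k; rewrite !nmM => K.
move: lM; rewrite ltr_pdivrMr // => lM.
rewrite -[_^-1]mul1r ltr_pdivlMr ?mulr_gt0 //.
have k0 := nm_ge0 k.
have rz2 : rho ^+ 2 <= nm z * nm z by rewrite expr2 ler_pM // ltW.
have K2 : nm k * nm l * rho ^+ 2 <= 2 * M.
  by have := ler_wpM2l (mulr_ge0 k0 (ltW nl)) rz2; lra.
have : nm k * (2 * rho) * (nm l * rho) < 1 * (nm l * rho) by lra.
by rewrite ltr_pM2r ?mulr_gt0.
Qed.

(** If the bound failed, [1 / z] would dominate the error of [Gboundary] on every side, and each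
    side would contribute positively to a circulation that is zero. *)
Lemma cauchy_estimate : nm (derive1 f w) <= 4 * M / rho.
Proof.
rewrite leNgt -/l; apply/negP => lM.
have M0 : 0 <= M by apply: le_trans (nm_ge0 _) (fM rho_in rho_in).
have nl : 0 < nm l by apply: le_lt_trans lM; rewrite divr_ge0 ?mulr_ge0 // ltW.
have l0 : l != 0 by rewrite -nm_gt0.
have r0 := rho0.
have rin : - rho <= rho <= rho by apply/andP; split; lra.
have Nrin : - rho <= - rho <= rho by apply/andP; split; lra.
have nr : `|rho| = rho by rewrite gtr0_norm.
have rN0 : rho != 0 by rewrite gt_eqF.
have NrN0 : - rho != 0 by rewrite oppr_eq0.
have NrR : - rho < rho by lra.
(* The right-hand side is the size of the component of [1 / z] integrated along a side; it is least
   at the corners. *)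
have core (t : R) : - rho <= t <= rho -> (2 * rho)^-1 <= rho / (rho ^+ 2 + t ^+ 2).
  move=> /andP[? ?].
  have t2 : t ^+ 2 <= rho ^+ 2 by nra.
  have r2 : 0 < rho ^+ 2 by rewrite exprn_gt0.
  have s0 : 0 < rho ^+ 2 + t ^+ 2 by have := sqr_ge0 t; lra.
  rewrite ler_pdivlMr // mulrC ler_pdivrMr ?mulr_gt0 //; lra.
have cont x y : - rho <= x <= rho -> - rho <= y <= rho -> (x != 0) || (y != 0) ->
    {for x, continuous (p ^~ y)} /\ {for y, continuous (q x)}.
  by move=> hx hy xy0; apply: closed_at_continuous; exact: Gclosed.
have bottom : 0 < itg (p ^~ (- rho)) (- rho) rho.
  apply: itg_gt0; [exact: NrR| |] => x hx.
    by have [] := cont x (- rho) hx Nrin; rewrite ?NrN0 ?orbT.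
  have [|k Gk kr] := Gboundary hx Nrin _ lM; first by rewrite normrN nr eqxx orbT.
  have := Im_le_nm k; rewrite /p Gk ImD Im_inv_mkC ler_norml => /andP[k1 k2].
  have := core x hx; rewrite [x ^+ 2 + _]addrC sqrrN mulNr; lra.
have top : itg (p ^~ rho) (- rho) rho < 0.
  apply: itg_lt0; [exact: NrR| |] => x hx.
    by have [] := cont x rho hx rin; rewrite ?rN0 ?orbT.
  have [|k Gk kr] := Gboundary hx rin _ lM; first by rewrite nr eqxx orbT.
  have := Im_le_nm k; rewrite /p Gk ImD Im_inv_mkC ler_norml => /andP[k1 k2].
  have := core x hx; rewrite [x ^+ 2 + _]addrC; lra.
have right : 0 < itg (q rho) (- rho) rho.
  apply: itg_gt0; [exact: NrR| |] => x hx.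
    by have [] := cont rho x rin hx; rewrite ?rN0.
  have [|k Gk kr] := Gboundary rin hx _ lM; first by rewrite nr eqxx.
  have := Re_le_nm k; rewrite /q Gk ReD Re_inv_mkC ler_norml => /andP[k1 k2].
  have := core x hx; lra.
have left : itg (q (- rho)) (- rho) rho < 0.
  apply: itg_lt0; [exact: NrR| |] => x hx.
    by have [] := cont (- rho) x Nrin hx; rewrite ?NrN0.
  have [|k Gk kr] := Gboundary Nrin hx _ lM; first by rewrite normrN nr eqxx.
  have := Re_le_nm k; rewrite /q Gk ReD Re_inv_mkC ler_norml => /andP[k1 k2].
  have := core x hx; rewrite sqrrN mulNr; lra.
have := circ_punctured_eq0 rho0 Gclosed (Gresidue l0).
rewrite /circ; lra.
Qed.

End Estimate.
End CauchyEstimate.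

(** * Bounds on discs and the theorem *)

Section DiscBounds.
Variable R : realType.
Local Notation C := (Cx R).
Local Notation Re := (@complex.Re R).
Local Notation Im := (@complex.Im R).

(** Compactness in the form of bisection of the surrounding square, for the property that [f] is
    bounded on the part of a rectangle lying in the disc. *)
Lemma continuous_disc_bounded (f : C -> C) (r : R) :
  (forall z, nm z <= r -> {for z, continuous f}) ->
  exists M : R, forall z, nm z <= r -> nm (f z) <= M.
Proof.
move=> cf; have [r0|r0] := ltP r 0.
  by exists 0 => z zr; have := nm_ge0 z; lra.
have Nr : - r <= r by lra.
pose P (a b c d : R) := exists M : R, forall x y, a <= x <= b -> c <= y <= d ->
  nm (mkC x y) <= r -> nm (f (mkC x y)) <= M.
have [M HM] : P (- r) r (- r) r.
  apply: rect_bisection => //.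
    move=> a b c d _ _ _ _ _ _ m n [M1 H1] [M2 H2] [M3 H3] [M4 H4].
    exists (Num.max (Num.max M1 M2) (Num.max M3 M4)).
    move=> x y /andP[ax xb] /andP[cy yd] xyr; rewrite !le_max.
    have [xm|/ltW mx] := leP x m; have [yn|/ltW ny] := leP y n.
    - by rewrite H1 ?ax ?xm ?cy ?yn.
    - by rewrite H3 ?ax ?xm ?ny ?yd ?orbT.
    - by rewrite H2 ?mx ?xb ?cy ?yn ?orbT.
    - by rewrite H4 ?mx ?xb ?ny ?yd ?orbT.
  move=> x y _ _; set z := mkC x y.
  have close (e : R) : 0 < e -> forall a b c d s t : R, a <= x <= b -> c <= y <= d ->
      b - a < e / 2 -> d - c < e / 2 -> a <= s <= b -> c <= t <= d ->
      nm (mkC s t - z) < e.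
    move=> e0 a b c d s t /andP[? ?] /andP[? ?] ? ? /andP[? ?] /andP[? ?].
    apply: le_lt_trans (nm_le_ReIm _) _ => /=.
    have : `|s - x| <= b - a by rewrite ler_norml; apply/andP; split; lra.
    have : `|t - y| <= d - c by rewrite ler_norml; apply/andP; split; lra.
    lra.
  have [zr|zr] := leP (nm z) r.
    have /continuous_nmP/(_ _ ltr01)[e e0 He] := cf z zr.
    exists (e / 2); first by rewrite divr_gt0.
    move=> a b c d _ xab _ _ ycd _ wab wcd; exists (nm (f z) + 1) => s t sab tcd _.
    have /He := close e e0 a b c d s t xab ycd wab wcd sab tcd.
    have := nmD (f (mkC s t) - f z) (f z); rewrite subrK; lra.
  have e0 : 0 < nm z - r by rewrite subr_gt0.
  exists ((nm z - r) / 2); first by rewrite divr_gt0.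
  (* Small rectangles around a point outside the closed disc miss the disc, so the bound [0] holds
     vacuously. *)
  move=> a b c d _ xab _ _ ycd _ wab wcd; exists 0 => s t sab tcd str.
  have := close _ e0 a b c d s t xab ycd wab wcd sab tcd.
  have := nmD (mkC s t) (z - mkC s t); rewrite addrC subrK nmBC; lra.
exists M => z zr.
have -> : z = mkC (Re z) (Im z) by case: (z).
apply: HM; rewrite -?ler_norml.
- exact: le_trans (Re_le_nm z) zr.
- exact: le_trans (Im_le_nm z) zr.
- by have -> : mkC (Re z) (Im z) = z by case: (z).
Qed.

Lemma holo_continuous (f : C -> C) (z : C) : holo f -> nm z < 1 -> {for z, continuous f}.
Proof.
move=> hf z1; apply/differentiable_continuous/derivable1_diffP.
by apply: hf; rewrite inDE.
Qed.

Lemma holo_disc_bounded (f : C -> C) (r : R) : holo f -> r < 1 ->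
  exists M : R, forall z, nm z <= r -> nm (f z) <= M.
Proof.
move=> hf r1; apply: continuous_disc_bounded => z zr.
by apply: holo_continuous => //; exact: le_lt_trans r1.
Qed.

(** Cauchy's estimate on squares of one fixed size around the points of the disc; all these squares
    lie in a larger disc on which [f] is bounded. *)
Lemma holo_derive_disc_bounded (f : C -> C) (r : R) : holo f -> r < 1 ->
  exists M : R, forall z, nm z <= r -> nm (derive1 f z) <= M.
Proof.
move=> hf r1.
have r'1 : (1 + r) / 2 < 1 by lra.
have [M HM] := holo_disc_bounded hf r'1.
(* Points of the square are within [2 * rho = (1 - r) / 2] of its centre, hence in the disc of
   radius [(1 + r) / 2]. *)
pose rho := (1 - r) / 4; have rho0 : 0 < rho by rewrite /rho; lra.
exists (4 * M / rho) => z zr.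
have sq (x y : R) : - rho <= x <= rho -> - rho <= y <= rho ->
    nm (z + mkC x y) <= (1 + r) / 2.
  rewrite -!ler_norml => hx hy; apply: le_trans (nmD _ _) _.
  by have := nm_le_ReIm (mkC x y); move: hx hy; rewrite /rho /=; lra.
apply: cauchy_estimate => // x y hx hy; last exact/HM/sq.
by apply: hf; rewrite inDE; apply: le_lt_trans r'1; exact: sq.
Qed.

End DiscBounds.

(** * Continuity of functionals and the weighted uniform bound *)

Section Functionals.
Variables (R : realType) (X : completeNormedModType (Cx R)).
Local Notation C := (Cx R).

Definition linear_functional (L : X -> C) :=
  forall (a : C) x y, L (a *: x + y) = a * L x + L y.

Lemma linear_continuousP (L : X -> C) : linear_functional L ->
  continuous L <-> exists M : R, forall x, nm (L x) <= M * nm x.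
Proof.
move=> Llin; split.
  move=> cL.
  (* Uniform boundedness of a one-member family is the boundedness of its member. *)
  have [||x|M HM] := @uniform_boundedness R X unit (fun _ => L).
  - by move=> _; exact: Llin.
  - by move=> _; exact: cL.
  - by exists (nm (L x)).
  by exists M => x; exact: HM tt x.
move=> [M HM] x; apply/continuous_nmP => e e0.
have M1 : 0 < `|M| + 1 by rewrite ltr_wpDl.
exists (e / (`|M| + 1)); first by rewrite divr_gt0.
move=> y; rewrite ltr_pdivlMr // => yx.
have -> : L y - L x = L (y - x).
  by rewrite [y - x]addrC -(scaleN1r x) Llin mulN1r addrC.
apply: le_lt_trans (HM _) _; apply: le_lt_trans yx.
rewrite mulrC ler_wpM2l ?nm_ge0 //; have := ler_norm M; lra.
Qed.

(** The common core of both equivalences. Uniform boundedness applies to the functionals [v z * K z]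
    over the disc; conversely, each [K z] is bounded after division by [v z > 0]. *)
Lemma weighted_uniform_bound (v : C -> R) (K : C -> X -> C) :
  (forall z, inD z -> 0 < v z <= 1) ->
  (forall z, inD z -> linear_functional (K z)) ->
  (forall x (r : R), r < 1 -> exists M : R, forall z, nm z <= r -> nm (K z x) <= M) ->
  weakstar_to0_bdry v K ->
  (forall z, inD z -> in_dual (K z)) <->
  exists M : R, forall x z, inD z -> v z * nm (K z x) <= M * nm x.
Proof.
move=> hv Klin Kloc Kw; split; last first.
  move=> [M HM] z Dz; apply/linear_continuousP; first exact: Klin.
  have /andP[v0 _] := hv z Dz; exists (M / v z) => x.
  by rewrite mulrAC ler_pdivlMr // mulrC HM.
move=> Kc.
pose L (i : {z : C | `[< inD z >]}) x := RtoC (v (sval i)) * K (sval i) x.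
have iD (i : {z : C | `[< inD z >]}) : inD (sval i) by apply/asboolP/(svalP i).
have nL i x : nm (L i x) = v (sval i) * nm (K (sval i) x).
  by have /andP[v0 _] := hv _ (iD i); rewrite /L nmM nmR // ltW.
have Llin i : linear_functional (L i).
  by move=> a x y; rewrite /L Klin // mulrDr mulrCA.
have [||x|M HM] := @uniform_boundedness R X _ L.
- exact: Llin.
- move=> i; apply/linear_continuousP; first exact: Llin.
  have /linear_continuousP[|M HM] := Kc _ (iD i); first exact: Klin.
  have /andP[v0 _] := hv _ (iD i).
  by exists (v (sval i) * M) => x; rewrite nL -mulrA ler_pM2l.
- have [r [r1 Hr]] := Kw x 1 ltr01; have [M HM] := Kloc x r r1.
  (* The bound [M] serves for [nm z <= r], where [v z <= 1]; beyond [r] the convergence with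
     tolerance [1] gives the bound [1]. *)
  exists (Num.max M 1) => i; rewrite le_max.
  have [zr|zr] := leP (nm (sval i)) r.
    have /andP[v0 v1] := hv _ (iD i); rewrite nL; apply/orP; left.
    apply: le_trans (HM _ zr); rewrite -[leRHS]mul1r.
    by rewrite ler_wpM2r // nm_ge0.
  have := Hr (sval i); rewrite !nmE !RtoC_lt => /(_ zr (iD i)) /ltW h.
  by apply/orP; right.
exists M => x z Dz.
have zP : `[< inD z >] by apply/asboolP.
by have := HM (exist _ z zP) x; rewrite nL.
Qed.

End Functionals.

(** * Linearity of the evaluation functionals *)

Section EvaluationFunctionals.
Variables (R : realType) (T : (Cx R -> Cx R) -> (Cx R -> Cx R)).
Variables (X : completeNormedModType (Cx R)) (j : X -> (Cx R -> Cx R)).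
Hypotheses (HT : linear_on_HD T) (Hj : embeds_in_HD j).
Local Notation C := (Cx R).

Lemma holo_Tj x : holo (T (j x)).
Proof. by case: HT => + _; apply; case: Hj. Qed.

Lemma KH_linear z : inD z -> linear_functional (KH j T z).
Proof.
move=> Dz a x y; rewrite /KH; have [hj jlin _] := Hj.
by rewrite jlin; case: HT => _ ->.
Qed.

(** Linearity of [T] holds pointwise on the disc only, so the two functions are compared on a
    neighbourhood of [z], which determines the derivative. *)
Lemma KB1_linear z : inD z -> linear_functional (KB1 j T z).
Proof.
move=> Dz a x y; rewrite /KB1 !derive1E.
have -> : 'D_1 (T (j (a *: x + y))) z = 'D_1 (a \*: T (j x) + T (j y)) z.
  apply: near_eq_derive; apply/nbhs_nmP.
  have z1 : 0 < 1 - nm z by move: Dz; rewrite inDE subr_gt0.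
  exists (1 - nm z) => // w wz; apply: KH_linear.
  rewrite inDE; have := nmD (w - z) z; rewrite subrK; lra.
by rewrite deriveD ?deriveZ //; [|apply: derivableZ|]; apply: holo_Tj.
Qed.

End EvaluationFunctionals.

Theorem theorem2p2 (R : realType) (v : Cx R -> R)
  (T : (Cx R -> Cx R) -> (Cx R -> Cx R))
  (X : completeNormedModType (Cx R)) (j : X -> (Cx R -> Cx R)) :
  typical_weight v -> linear_on_HD T -> embeds_in_HD j ->
  (bounded_to_Hv0 v j T <->
     (forall z, inD z -> in_dual (KH j T z)) /\
     weakstar_to0_bdry v (KH j T))
  /\
  (bounded_to_Bv0 v j T <->
     [/\ in_dual (KB0 j T),
         (forall z, inD z -> in_dual (KB1 j T z))
       & weakstar_to0_bdry v (KB1 j T)]).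
Proof.
move=> [[_ hv] _ _ _] HT Hj; have hTj := holo_Tj HT Hj.
have D0 : inD (0 : Cx R) by rewrite inDE nm0.
have ubH := weighted_uniform_bound hv (KH_linear HT Hj)
  (fun x r => holo_disc_bounded (hTj x)).
have ubB := weighted_uniform_bound hv (KB1_linear HT Hj)
  (fun x r => holo_derive_disc_bounded (hTj x)).
have cB0 := linear_continuousP (KH_linear HT Hj D0).
split; split.
(* Membership of every [T (j x)] in the little space is, besides holomorphy, literally the weak-star
   convergence. *)
- move=> [hH [M HM]]; have w x := (hH x).2.
  split => //; apply/(ubH w); exists M => x z Dz.
  by have := HM x z Dz; rewrite !nmE -!RtoCM RtoC_le.
- move=> [/ubH h w]; have [M HM] := h w; split; first by move=> x; split; [exact: hTj|exact: w].
  by exists M => x z Dz; rewrite !nmE -!RtoCM RtoC_le; exact: HM.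
- move=> [hB [M HM]]; have w x := (hB x).2.
  have {}HM x z : inD z ->
      nm (T (j x) 0) + v z * nm (derive1 (T (j x)) z) <= M * nm x.
    by move=> /(HM x); rewrite !nmE -!RtoCM -RtoCD RtoC_le.
  split => //.
    (* The bound at any one point of the disc controls the value at [0]; the point [0] is taken. *)
    apply/cB0; exists M => x; apply: le_trans (HM x 0 D0).
    by rewrite lerDl mulr_ge0 ?nm_ge0 // ltW //; case/andP: (hv 0 D0).
  apply/(ubB w); exists M => x z Dz; apply: le_trans (HM x z Dz).
  by rewrite lerDr nm_ge0.
- move=> [/cB0[M0 HM0] /ubB h w]; have [M HM] := h w.
  split; first by move=> x; split; [exact: hTj|exact: w].
  (* [M0] bounds the value at [0] and [M] the weighted derivative. *)
  exists (M0 + M) => x z Dz; rewrite !nmE -!RtoCM -RtoCD RtoC_le mulrDl.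
  by apply: lerD; [exact: HM0|exact: HM].
Qed.
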